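(* Let $p$ be an odd prime, and let $$C(Y)=\sum_{n\ge0}u_{np}Y^n\in\mathbf Z_p[[Y]],\qquad L(Y)=\frac{\theta C(Y)}{C(Y)}.$$ There is an explicit $1$-Lipschitz map $\mathcal T_p:\mathbf Z_p[[Y]]\to\mathbf Z_p[[Y]]$, defined solely from $q$, $P_p$ and $\theta$ (namely the map given in the context), such that $$L=L_{0,p}+p\,\mathcal T_p(L),\qquad L_{0,p}=\Phi_p(-q)-D_p.$$ Thus the map $H\mapsto L_{0,p}+p\mathcal T_p(H)$ is a strict $p$-adic contraction: if $H\equiv H'\pmod{p^r}$ then the images are congruent modulo $p^{r+1}$. If $$L^{(0)}=L_{0,p},\qquad L^{(j+1)}=L_{0,p}+p\,\mathcal T_p(L^{(j)})\quad(j\ge0),$$ then $L^{(r-1)}\equiv L\pmod{p^r}$ for all $r\ge1$.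
   Context: $p$ is an odd prime. The Artin--Hasse exponential is $\operatorname{AH}_p(X)=\exp\left(\sum_{i\ge0}X^{p^i}/p^i\right)=\sum_{n\ge0}u_nX^n\in\mathbf Z_p[[X]]$. $\theta=Y\,\frac{d}{dY}$. Put $q(Y)=\sum_{i\ge0}Y^{p^i}$, $P_p(Z)=Z(Z-1)\cdots(Z-p+1)$, $$\Phi_p(Z)=\frac{P_p(Z)-(Z^p-Z)}{p}\in\mathbf Z[Z],\qquad D_p(Y)=\frac{q(Y)^p-q(Y^p)}{p}\in\mathbf Z[[Y]].$$ Congruences modulo $p^r$ between power series are coefficientwise. A map $\mathcal T$ on $\mathbf Z_p[[Y]]$ is $1$-Lipschitz if $H\equiv H'\pmod{p^r}$ implies $\mathcal T(H)\equiv\mathcal T(H')\pmod{p^r}$ for every $r\ge1$. Definition of $\mathcal T_p$: put $f=-q$; for $h\in\mathbf Z_p[[Y]]$ let $M_h$ be the operator of multiplication by $h$ on $\mathbf Z_p[[Y]]$; for $H\in\mathbf Z_p[[Y]]$ put $E_H=\theta+M_H$, $T_H=M_f+pE_H$, $$Q_f(H)=\frac{T_H^p-M_f^p}{p^2},\qquad V_f(H)=\frac{\Phi_p(T_H)-M_{\Phi_p(f)}}{p}$$ (these are operators mapping $\mathbf Z_p[[Y]]$ to itself), and $\mathcal T_p(H)=\bigl(Q_f(H)+V_f(H)\bigr)1$, the value at the constant series $1$. *)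

(* Defs.v *)
From HB Require Import structures.
From mathcomp Require Import all_boot all_order all_algebra.
From mathcomp Require Import boolp.

Set Implicit Arguments.
Unset Strict Implicit.
Unset Printing Implicit Defensive.

Import GRing.Theory.
Local Open Scope ring_scope.

(* p-adic integers, as the inverse limit of the rings Z/p^n: [residue x n] is
   the representative of x mod p^n in [0, p^n), which the single compatibility
   condition already forces.  [prime p] is a parameter of the type so that the
   ring structures below can be attached to it. *)
Record padic_int (p : nat) (p_pr : prime p) := PadicInt {
  residue : nat -> nat;
  residue_compat : forall n, (residue n.+1 %% p ^ n = residue n)%N }.

Section PadicIntRing.
Variables (p : nat) (p_pr : prime p).
Local Notation Zp := (padic_int p_pr).
Implicit Types x y z : Zp.

HB.instance Definition _ := gen_eqMixin Zp.
HB.instance Definition _ := gen_choiceMixin Zp.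

Let pX_gt0 n : (0 < p ^ n)%N.
Proof. by rewrite expn_gt0 prime_gt0. Qed.

Lemma modn_residue x n : (residue x n %% p ^ n = residue x n)%N.
Proof. by rewrite -residue_compat modn_mod. Qed.

Lemma padic_intP x y :
  (forall n, (residue x n = residue y n %[mod p ^ n])%N) -> x = y.
Proof.
move=> exy; have {exy} : residue x = residue y.
  by apply/funext => n; have := exy n; rewrite !modn_residue.
case: x y => [x Hx] [y Hy] /= exy; rewrite {x}exy in Hx *.
by congr PadicInt; exact: Prop_irrelevance.
Qed.

Let mk_compat (f : nat -> nat) :
  (forall n, (f n.+1 = f n %[mod p ^ n])%N) ->
  forall n, ((f n.+1 %% p ^ n.+1) %% p ^ n = f n %% p ^ n)%N.
Proof. by move=> Hf n; rewrite modn_dvdm ?Hf // dvdn_exp2l. Qed.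

Definition padic_mk f Hf : Zp := PadicInt p_pr (@mk_compat f Hf).

Let residueS x n : (residue x n.+1 = residue x n %[mod p ^ n])%N.
Proof. by rewrite residue_compat modn_residue. Qed.

Lemma padic_nat_subproof (m n : nat) : (m = m %[mod p ^ n])%N.
Proof. by []. Qed.
Lemma padic_add_subproof x y n :
  (residue x n.+1 + residue y n.+1 = residue x n + residue y n %[mod p ^ n])%N.
Proof. by rewrite -modnDm !residueS modnDm. Qed.
Lemma padic_mul_subproof x y n :
  (residue x n.+1 * residue y n.+1 = residue x n * residue y n %[mod p ^ n])%N.
Proof. by rewrite -modnMm !residueS modnMm. Qed.
Lemma padic_opp_subproof x n :
  (p ^ n.+1 - residue x n.+1 = p ^ n - residue x n %[mod p ^ n])%N.
Proof.
have le_x m : (residue x m <= p ^ m)%N.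
  by rewrite -modn_residue ltnW // ltn_mod.
apply/eqP; rewrite -(eqn_modDr (residue x n.+1)) subnK //.
by rewrite -modnDmr residueS modnDmr subnK // modnn expnS modnMl.
Qed.

Definition padic_nat m := padic_mk (padic_nat_subproof m).
Definition padic_add x y := padic_mk (padic_add_subproof x y).
Definition padic_mul x y := padic_mk (padic_mul_subproof x y).
Definition padic_opp x := padic_mk (padic_opp_subproof x).

Lemma padic_addA : associative padic_add.
Proof.
by move=> x y z; apply: padic_intP => n /=; rewrite modnDml modnDmr addnA.
Qed.
Lemma padic_addC : commutative padic_add.
Proof. by move=> x y; apply: padic_intP => n /=; rewrite addnC. Qed.
Lemma padic_add0 : left_id (padic_nat 0) padic_add.
Proof. by move=> x; apply: padic_intP => n /=; rewrite mod0n modn_mod. Qed.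
Lemma padic_addN : left_inverse (padic_nat 0) padic_opp padic_add.
Proof.
move=> x; apply: padic_intP => n /=.
rewrite modn_mod modnDml subnK ?modnn ?mod0n //.
by rewrite -modn_residue ltnW // ltn_mod.
Qed.
HB.instance Definition _ :=
  GRing.isZmodule.Build Zp padic_addA padic_addC padic_add0 padic_addN.

Lemma padic_mulA : associative padic_mul.
Proof.
by move=> x y z; apply: padic_intP => n /=; rewrite !modn_mod modnMml modnMmr mulnA.
Qed.
Lemma padic_mulC : commutative padic_mul.
Proof. by move=> x y; apply: padic_intP => n /=; rewrite mulnC. Qed.
Lemma padic_mul1 : left_id (padic_nat 1) padic_mul.
Proof. by move=> x; apply: padic_intP => n /=; rewrite modn_mod modnMml mul1n. Qed.
Lemma padic_mulDl : left_distributive padic_mul padic_add.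
Proof.
move=> x y z; apply: padic_intP => n /=.
by rewrite !modn_mod modnMml modnDm mulnDl.
Qed.
Lemma padic_1neq0 : padic_nat 1 != padic_nat 0.
Proof.
apply/eqP => /(congr1 (fun x => residue x 1)) /=.
by rewrite expn1 mod0n modn_small // prime_gt1.
Qed.
HB.instance Definition _ := GRing.Zmodule_isComNzRing.Build Zp
  padic_mulA padic_mulC padic_mul1 padic_mulDl padic_1neq0.

End PadicIntRing.

(* Inverses in an arbitrary commutative ring, picked by choice; used for Z_p and
   for power series, where [x^-1] is thus the true inverse whenever one exists. *)
Section ClassicalInverse.
Variable R : comNzRingType.
Implicit Types x y : R.

Definition classical_unit : {pred R} := fun x => `[< exists y, y * x = 1 >].

Definition classical_inv x : R :=
  if pselect (exists y, y * x = 1) is left ex then projT1 (cid ex) else x.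

Lemma classical_mulVr : {in classical_unit, left_inverse 1 classical_inv *%R}.
Proof.
move=> x /asboolP ex; rewrite /classical_inv.
by case: pselect => // ex'; case: (cid ex').
Qed.

Lemma classical_unitP x y : y * x = 1 -> classical_unit x.
Proof. by move=> yx1; apply/asboolP; exists y. Qed.

Lemma classical_inv_out : {in [predC classical_unit], classical_inv =1 id}.
Proof.
move=> x /asboolP nex; rewrite /classical_inv.
by case: pselect.
Qed.

End ClassicalInverse.

Section PadicIntDomain.
Variables (p : nat) (p_pr : prime p).
Local Notation Zp := (padic_int p_pr).
Implicit Types x y : Zp.

HB.instance Definition _ := GRing.ComNzRing_hasMulInverse.Build Zp
  (@classical_mulVr Zp) (@classical_unitP Zp) (@classical_inv_out Zp).

Lemma residue_dvd x n k : (p ^ n %| residue x (n + k))%N = (residue x n == 0)%N.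
Proof.
rewrite -[in RHS](modn_residue x n) -/(dvdn _ _); elim: k => [|k IH].
  by rewrite addn0.
rewrite -IH /dvdn; congr (_ == _).
rewrite addnS -(residue_compat x (n + k)) modn_dvdm //.
by rewrite dvdn_exp2l // leq_addr.
Qed.

Lemma padic_int_integral x y : x * y = 0 -> (x == 0) || (y == 0).
Proof.
have nzP (z : Zp) : z != 0 -> exists n, residue z n != 0%N.
  move=> /eqP nz; apply: contrapT => nex; apply: nz; apply: padic_intP => n /=.
  rewrite modn_mod mod0n modn_residue; apply: contrapT => h; apply: nex; exists n.
  exact/eqP.
move=> xy0; rewrite -[_ || _]negbK negb_or; apply/negP => /andP[].
move=> /nzP[m] xm /nzP[k] yk.
have /eqP := congr1 (fun z => residue z (m + k)) xy0.
rewrite /= mod0n -/(dvdn _ _).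
rewrite -(residue_dvd _ _ k) in xm; rewrite -(residue_dvd _ _ m) addnC in yk.
set a := residue x _ in xm *; set b := residue y _ in yk *.
have a0 : (0 < a)%N by rewrite lt0n; apply: contra xm => /eqP ->; rewrite dvdn0.
have b0 : (0 < b)%N by rewrite lt0n; apply: contra yk => /eqP ->; rewrite dvdn0.
rewrite pfactor_dvdn // -?ltnNge in xm; rewrite pfactor_dvdn // -?ltnNge in yk.
rewrite pfactor_dvdn ?muln_gt0 ?a0 // lognM //.
by rewrite leqNgt => /negP; apply; rewrite -addnS leq_add // ltnW.
Qed.

HB.instance Definition _ :=
  GRing.ComUnitRing_isIntegral.Build Zp padic_int_integral.

End PadicIntDomain.

(* Q_p; Z_p embeds in it through [tofrac] *)
Definition padic (p : nat) (p_pr : prime p) : fieldType :=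
  {fraction (padic_int p_pr)}.

Record fps (R : Type) := FPS { fps_coef : nat -> R }.

Section FpsRing.
Variable R : comNzRingType.
Implicit Types F G H : fps R.

HB.instance Definition _ := gen_eqMixin (fps R).
HB.instance Definition _ := gen_choiceMixin (fps R).

Lemma fpsP F G : fps_coef F =1 fps_coef G -> F = G.
Proof. by case: F G => [f] [g] /= /funext ->. Qed.

Definition fps_const (c : R) := FPS (fun n => if n == 0%N then c else 0).
Definition fps_add F G := FPS (fun n => fps_coef F n + fps_coef G n).
Definition fps_opp F := FPS (fun n => - fps_coef F n).
Definition fps_scale c F := FPS (fun n => c * fps_coef F n).
Definition fps_mul F G :=
  FPS (fun n => \sum_(i < n.+1) fps_coef F i * fps_coef G (n - i)%N).

Lemma fps_addA : associative fps_add.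
Proof. by move=> F G H; apply: fpsP => n /=; rewrite addrA. Qed.
Lemma fps_addC : commutative fps_add.
Proof. by move=> F G; apply: fpsP => n /=; rewrite addrC. Qed.
Lemma fps_add0 : left_id (fps_const 0) fps_add.
Proof. by move=> F; apply: fpsP => n /=; case: eqP => _; rewrite add0r. Qed.
Lemma fps_addN : left_inverse (fps_const 0) fps_opp fps_add.
Proof. by move=> F; apply: fpsP => n /=; case: eqP => _; rewrite addNr. Qed.
HB.instance Definition _ :=
  GRing.isZmodule.Build (fps R) fps_addA fps_addC fps_add0 fps_addN.

Let trunc m F : {poly R} := \poly_(i < m) fps_coef F i.

Let coef_mul_trunc m F G n : (n < m)%N ->
  fps_coef (fps_mul F G) n = (trunc m F * trunc m G)`_n.
Proof.
move=> nm; rewrite coefM /=; apply: eq_bigr => i _.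
rewrite !coef_poly (leq_ltn_trans (leq_subr _ _) nm).
by rewrite (leq_ltn_trans _ nm) // -ltnS.
Qed.

Lemma fps_mulC : commutative fps_mul.
Proof.
by move=> F G; apply: fpsP => n; rewrite !(@coef_mul_trunc n.+1) // mulrC.
Qed.
Lemma fps_mulA : associative fps_mul.
Proof.
move=> F G H; apply: fpsP => n.
transitivity (trunc n.+1 F * (trunc n.+1 G * trunc n.+1 H))`_n.
  rewrite coefM; apply: eq_bigr => i _; rewrite coef_poly ltn_ord.
  by rewrite -coef_mul_trunc // ltnS leq_subr.
rewrite mulrA coefM; apply: eq_bigr => i _.
by rewrite coef_poly ltnS leq_subr -coef_mul_trunc.
Qed.
Lemma fps_mul1 : left_id (fps_const 1) fps_mul.
Proof.
move=> F; apply: fpsP => n /=; rewrite big_ord_recl /= mul1r subn0.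
by rewrite big1 ?addr0 // => i _; rewrite mul0r.
Qed.
Lemma fps_mulDl : left_distributive fps_mul fps_add.
Proof.
move=> F G H; apply: fpsP => n /=; rewrite -big_split.
by apply: eq_bigr => i _; rewrite mulrDl.
Qed.
Lemma fps_1neq0 : fps_const 1 != fps_const 0.
Proof.
by apply/eqP => /(congr1 (fun F => fps_coef F 0)) /= /eqP; rewrite oner_eq0.
Qed.
HB.instance Definition _ := GRing.Zmodule_isComNzRing.Build (fps R)
  fps_mulA fps_mulC fps_mul1 fps_mulDl fps_1neq0.

Lemma fps_scaleA a b F : fps_scale a (fps_scale b F) = fps_scale (a * b) F.
Proof. by apply: fpsP => n /=; rewrite mulrA. Qed.
Lemma fps_scale1 : left_id 1 fps_scale.
Proof. by move=> F; apply: fpsP => n /=; rewrite mul1r. Qed.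
Lemma fps_scaleDr : right_distributive fps_scale +%R.
Proof. by move=> a F G; apply: fpsP => n /=; rewrite mulrDr. Qed.
Lemma fps_scaleDl F : {morph fps_scale^~ F : a b / a + b}.
Proof. by move=> a b; apply: fpsP => n /=; rewrite mulrDl. Qed.
HB.instance Definition _ := GRing.Zmodule_isLmodule.Build R (fps R)
  fps_scaleA fps_scale1 fps_scaleDr fps_scaleDl.

Lemma fps_scaleAl (a : R) F G : a *: (F * G) = a *: F * G.
Proof.
apply: fpsP => n /=; rewrite big_distrr /=.
by apply: eq_bigr => i _; rewrite mulrA.
Qed.
HB.instance Definition _ := GRing.Lmodule_isLalgebra.Build R (fps R) fps_scaleAl.
HB.instance Definition _ := GRing.Lalgebra_isComAlgebra.Build R (fps R).

HB.instance Definition _ := GRing.ComNzRing_hasMulInverse.Build (fps R)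
  (@classical_mulVr (fps R)) (@classical_unitP (fps R))
  (@classical_inv_out (fps R)).

End FpsRing.

(* Everything is defined over a field K, meant to be Q_p, so that divisions by p
   are literal; that the results stay in Z_p[[Y]] is expressed by
   [fps_integral] below. *)
Section ArtinHasse.
Variables (K : fieldType) (p : nat).
Implicit Types F G H : fps K.

(* S^k only contributes in degrees >= k, since S is meant to have zero constant
   term; hence the finite sum *)
Definition fps_exp (S : fps K) : fps K :=
  FPS (fun n => \sum_(k < n.+1) fps_coef (S ^+ k) n / k`!%:R).

(* sums over i >= 0 of monomials in X^(p^i): in degree n only i <= n matter,
   as i < p^i *)
Definition artin_hasse : fps K :=
  fps_exp (FPS (fun n => \sum_(i < n.+1 | n == (p ^ i)%N) (p ^ i)%N%:R^-1)).

Definition q_series : fps K :=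
  FPS (fun n => \sum_(i < n.+1 | n == (p ^ i)%N) 1).

Definition C_series : fps K := FPS (fun n => fps_coef artin_hasse (n * p)%N).

Definition theta F : fps K := FPS (fun n => n%:R * fps_coef F n).

Definition L_series : fps K := theta C_series / C_series.

(* F(Y^p) *)
Definition fps_subst_p F : fps K :=
  FPS (fun n => if (p %| n)%N then fps_coef F (n %/ p) else 0).

Definition falling_poly : {poly K} := \prod_(i < p) ('X - (i%:R)%:P).

Definition Phi : {poly K} := p%:R^-1 *: (falling_poly - ('X^p - 'X)).

Definition D_series : fps K :=
  p%:R^-1 *: (q_series ^+ p - fps_subst_p q_series).

Definition L0_series : fps K := horner_alg (- q_series) Phi - D_series.

Definition op_mul (h : fps K) : fps K -> fps K := fun G => h * G.

(* P(T) for an operator T *)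
Definition op_poly (P : {poly K}) (T : fps K -> fps K) : fps K -> fps K :=
  fun G => \sum_(i < size P) P`_i *: iter i T G.

Definition f_series : fps K := - q_series.

Definition op_E H : fps K -> fps K := fun G => theta G + op_mul H G.

Definition op_T H : fps K -> fps K :=
  fun G => op_mul f_series G + p%:R *: op_E H G.

Definition op_Q H : fps K -> fps K := fun G =>
  (p ^ 2)%N%:R^-1 *: (iter p (op_T H) G - iter p (op_mul f_series) G).

Definition op_V H : fps K -> fps K := fun G =>
  p%:R^-1 *: (op_poly Phi (op_T H) G - op_mul (horner_alg f_series Phi) G).

Definition calT H : fps K := op_Q H 1 + op_V H 1.

End ArtinHasse.

Section PadicSeries.
Variables (p : nat) (p_pr : prime p).

(* F lies in Z_p[[Y]], seen inside Q_p[[Y]] *)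
Definition fps_integral (F : fps (padic p_pr)) : Prop :=
  forall n, exists z : padic_int p_pr, fps_coef F n = tofrac z.

Definition fps_congr (r : nat) (F G : fps (padic p_pr)) : Prop :=
  forall n, exists z : padic_int p_pr,
    fps_coef F n - fps_coef G n = (p ^ r)%N%:R * tofrac z.

End PadicSeries.

(* Main.v *)
Require Import Defs.
From HB Require Import structures.
From mathcomp Require Import all_boot all_order all_algebra finfield.
From mathcomp Require Import boolp ring.

Set Implicit Arguments.
Unset Strict Implicit.
Unset Printing Implicit Defensive.

Import GRing.Theory.
Local Open Scope ring_scope.

(** The logarithmic derivative of AH is [q(X)], so [theta AH = q AH], and [q]
    splits as [q(X) = X + q(X^p)].  Write [Y = X^p] and let [A_j] be the
    series collecting the coefficients of AH in degrees [np + j], so that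
    [C = A_0].  The differential equation becomes the cyclic system
    [(T + j) A_j = A_(j-1)] for [0 < j < p] and [T C = Y A_(p-1)], where
    [T = p theta - q].  As [T Y = Y (T + p)], going once around the cycle gives
    [P_p(T) C = Y C] ([C_series_falling]).  Conjugation by [C] turns [theta]
    into [theta + L] and hence [T] into [T_L], so [P_p(T_L) 1 = Y]
    ([falling_op_T_L]).  Expanding [P_p(Z) = Z^p - Z + p Phi_p(Z)] and dividing
    by [p], this is exactly the fixed point equation for [L]
    ([L_series_fixed_point]).

    Everything else is a matter of divisibility by powers of [p].  AH is
    integral by Dwork's argument: [AH^p = AH(X^p) exp(pX)], both sides solving
    the same first order equation, where [exp(pX)] is [1] modulo [p] and
    [F^p] is [F(X^p)] modulo [p] for integral [F] ([fdvd_artin_hasse]).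
    For the operators, write [T_H = f + pE]; since [E f = f E + theta f],
    the first order term of [T_H^n] is
    [p (n f^(n-1) E + 'C(n, 2) f^(n-2) theta f)], and for [n = p] odd both
    coefficients are divisible by [p]; hence [p^2] divides [T_H^p - f^p].
    Similarly, if [H] and [H'] agree modulo [p^r], replacing one by the other
    changes [T_H^n] by [p n f^(n-1) (H - H')] modulo [p^(r+2)]
    ([iter_op_T_variation]), and for [n = p] this is [0] modulo [p^(r+2)].
    So [calT] is integral and 1-Lipschitz; the factor [p] in front of it makes
    the iteration a contraction with fixed point [L]. *)

(** * Power series over a commutative ring *)

Section PowerSeries.
Variable R : comNzRingType.
Implicit Types F G : fps R.

Lemma fps_coefM F G n :
  fps_coef (F * G) n = \sum_(i < n.+1) fps_coef F i * fps_coef G (n - i)%N.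
Proof. by []. Qed.

Lemma fps_coef1 n : fps_coef (1 : fps R) n = (n == 0%N)%:R.
Proof. by rewrite /= ; case: (n == _). Qed.

Lemma fps_coefD F G n : fps_coef (F + G) n = fps_coef F n + fps_coef G n.
Proof. by []. Qed.

Lemma fps_coefB F G n : fps_coef (F - G) n = fps_coef F n - fps_coef G n.
Proof. by []. Qed.

Lemma fps_coefZ c F n : fps_coef (c *: F) n = c * fps_coef F n.
Proof. by []. Qed.

Lemma fps_coef_sum I (r : seq I) (P : pred I) (F : I -> fps R) n :
  fps_coef (\sum_(i <- r | P i) F i) n = \sum_(i <- r | P i) fps_coef (F i) n.
Proof.
apply: (big_morph (fun F => fps_coef F n)) => //=.
by case: eqP.
Qed.

Lemma fps_coefM0 F G : fps_coef (F * G) 0 = fps_coef F 0 * fps_coef G 0.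
Proof. by rewrite fps_coefM big_ord1. Qed.

Lemma fps_coefX0 F n : fps_coef (F ^+ n) 0 = fps_coef F 0 ^+ n.
Proof. by elim: n => [|n IH] //; rewrite !exprS fps_coefM0 IH. Qed.

Lemma fps_coefM_local F F' G G' n :
    (forall i, (i <= n)%N -> fps_coef F i = fps_coef F' i) ->
    (forall i, (i <= n)%N -> fps_coef G i = fps_coef G' i) ->
  fps_coef (F * G) n = fps_coef (F' * G') n.
Proof.
move=> eF eG; rewrite !fps_coefM; apply: eq_bigr => i _.
by rewrite eF ?eG ?leq_subr // -ltnS.
Qed.

Definition fps_X : fps R := FPS (fun n => (n == 1%N)%:R).
Definition fps_shift n F : fps R := FPS (fun i => fps_coef F (n + i)%N).

Lemma coef_fps_XM F n :
  fps_coef (fps_X * F) n = if n is m.+1 then fps_coef F m else 0.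
Proof.
rewrite fps_coefM; case: n => [|m]; first by rewrite big_ord1 mul0r.
rewrite 2!big_ord_recl /= mul0r add0r mul1r subSS subn0 big1 ?addr0 // => i _.
by rewrite mul0r.
Qed.

Lemma coef_fps_XnM k F n :
  fps_coef (fps_X ^+ k * F) n = if (n < k)%N then 0 else fps_coef F (n - k)%N.
Proof.
elim: k n => [|k IH] n; first by rewrite mul1r subn0.
by rewrite exprS -mulrA coef_fps_XM; case: n.
Qed.

(** Splitting off the constant term is how statements about a fixed coefficient
    are proved by induction on its degree, without truncating series. *)
Lemma fps_head_tail F : F = fps_coef F 0 *: 1 + fps_X * fps_shift 1 F.
Proof.
apply: fpsP => n; rewrite fps_coefD fps_coefZ fps_coef1 coef_fps_XM.
by case: n => [|n] /=; rewrite ?mulr1 ?addr0 // mulr0 add0r.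
Qed.

Lemma fps_coef_expr_small F k n :
  fps_coef F 0 = 0 -> (n < k)%N -> fps_coef (F ^+ k) n = 0.
Proof.
move=> F0 nk; have -> : F = fps_X * fps_shift 1 F.
  by rewrite {1}[F]fps_head_tail F0 scale0r add0r.
by rewrite exprMn coef_fps_XnM nk.
Qed.

(** Exponentials and geometric series have coefficients given by sums whose
    length grows with the degree; up to any given degree they coincide with an
    honest finite sum of powers, to which algebra applies. *)
Lemma fps_coef_power_sum_cut (c : nat -> R) F m n :
    fps_coef F 0 = 0 -> (m <= n)%N ->
  \sum_(k < m.+1) c k * fps_coef (F ^+ k) m =
  fps_coef (\sum_(k < n.+1) c k *: F ^+ k) m.
Proof.
move=> F0 le_mn; rewrite fps_coef_sum.
rewrite (big_ord_widen n.+1 (fun k => c k * fps_coef (F ^+ k) m)) // big_mkcond.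
apply: eq_bigr => k _; rewrite fps_coefZ; case: ifP => // /negbT.
by rewrite -leqNgt => mk; rewrite fps_coef_expr_small ?mulr0.
Qed.

(** The geometric series in [1 - F]. *)
Lemma fps_has_inverse F : fps_coef F 0 = 1 -> exists G, G * F = 1.
Proof.
move=> F0; pose N := 1 - F.
have N0 : fps_coef N 0 = 0 by rewrite /= F0 subrr.
exists (FPS (fun n => \sum_(k < n.+1) 1 * fps_coef (N ^+ k) n)).
apply: fpsP => n.
rewrite (@fps_coefM_local _ (\sum_(k < n.+1) 1 *: N ^+ k) _ F) //.
  under eq_bigr do rewrite scale1r.
  have -> : F = - (N - 1) by rewrite /N addrC addKr opprK.
  rewrite mulrC mulNr -subrX1 opprB fps_coefB (fps_coef_expr_small N0) //.
  by rewrite subr0.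
by move=> i /(fps_coef_power_sum_cut (fun=> 1) N0) <-.
Qed.

(** In the binomial expansion, the terms of order at least two in [fps_X ^+ n * B]
    start in degree [2 n > n]. *)
Lemma fps_coef_expr_perturb (A B : fps R) n k :
    (0 < n)%N -> fps_coef A 0 = 1 ->
  fps_coef ((A + fps_X ^+ n * B) ^+ k) n
    = fps_coef (A ^+ k) n + k%:R * fps_coef B 0.
Proof.
move=> n_gt0 A0.
suff [B' -> B'0] : exists2 B',
    (A + fps_X ^+ n * B) ^+ k = A ^+ k + fps_X ^+ n * B' & fps_coef B' 0 = k%:R * fps_coef B 0.
  by rewrite fps_coefD coef_fps_XnM ltnn subnn B'0.
have Xn0 : fps_coef (fps_X ^+ n) 0 = 0.
  by rewrite fps_coefX0 expr0n eqn0Ngt n_gt0.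
elim: k => [|k [B' IH B'0]].
  by exists 0; rewrite ?mulr0 ?addr0 ?mul0r.
exists (B * A ^+ k + A * B' + fps_X ^+ n * B * B').
  by rewrite exprS IH exprS; ring.
rewrite !fps_coefD !fps_coefM0 Xn0 fps_coefX0 A0 expr1n B'0 -natr1; ring.
Qed.

End PowerSeries.

(** * The Euler operator and first order equations *)

Section Euler.
Variable K : fieldType.
Implicit Types F G S : fps K.

Lemma fps_coef_theta F n : fps_coef (theta F) n = n%:R * fps_coef F n.
Proof. by []. Qed.

Lemma thetaD F G : theta (F + G) = theta F + theta G.
Proof. by apply: fpsP => n /=; rewrite mulrDr. Qed.

Lemma thetaZ c F : theta (c *: F) = c *: theta F.
Proof. by apply: fpsP => n /=; rewrite mulrCA. Qed.

Lemma theta1 : theta 1 = 0 :> fps K.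
Proof. by apply: fpsP => -[|n] /=; rewrite ?mul0r ?mulr0. Qed.

Lemma thetaM F G : theta (F * G) = theta F * G + F * theta G.
Proof.
apply: fpsP => n; rewrite fps_coefD /= mulr_sumr -big_split.
apply: eq_bigr => i _ /=; rewrite -{1}(subnKC (leq_ord i)) natrD; ring.
Qed.

Lemma theta_exp F n : theta (F ^+ n) = n%:R * F ^+ n.-1 * theta F.
Proof.
elim: n => [|n IH]; first by rewrite theta1 !mul0r.
rewrite exprS thetaM {}IH; case: n => [|n] /=; first by ring.
by rewrite !exprS -[n.+2]addn1 natrD; ring.
Qed.

Lemma theta_fps_X : theta (fps_X K) = fps_X K.
Proof. by apply: fpsP => -[|[|n]] /=; rewrite ?mulr0 ?mulr1. Qed.

HB.instance Definition _ := GRing.isLinear.Build K (fps K) (fps K) _ (@theta K)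
  (fun a F G => etrans (thetaD (a *: F) G) (congr1 (+%R^~ _) (thetaZ a F))).

Hypothesis char0 : forall n, n.+1%:R != 0 :> K.

(** Degree [n] of the equation reads [n F_n = sum_(i < n) S_(n-i) F_i], and
    [n] is invertible: this recursion determines [F] from its constant term. *)
Lemma theta_linear_uniq S F G :
    fps_coef S 0 = 0 -> fps_coef F 0 = fps_coef G 0 ->
  theta F = S * F -> theta G = S * G -> F = G.
Proof.
move=> S0 FG0 dF dG; apply: fpsP => n.
elim/ltn_ind: n => -[|n] IH //; apply: (mulfI (char0 n)).
have dE H : theta H = S * H ->
    n.+1%:R * fps_coef H n.+1
      = \sum_(i < n.+1) fps_coef S i.+1 * fps_coef H (n - i).
  move=> /(congr1 (fun F => fps_coef F n.+1)) /= ->.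
  by rewrite big_ord_recl S0 mul0r add0r.
rewrite !dE //; apply: eq_bigr => i _; rewrite IH //.
by rewrite ltnS leq_subr.
Qed.

Lemma theta_fps_exp S :
  fps_coef S 0 = 0 -> theta (fps_exp S) = theta S * fps_exp S.
Proof.
move=> S0; pose E N := \sum_(k < N) k`!%:R^-1 *: S ^+ k.
have coefE m n : (m <= n)%N -> fps_coef (fps_exp S) m = fps_coef (E n.+1) m.
  move=> le_mn; rewrite -(fps_coef_power_sum_cut (fun k => k`!%:R^-1)) //.
  by apply: eq_bigr => k _; rewrite mulrC.
have dE N : theta (E N.+1) = theta S * E N.
  rewrite /E big_ord_recl linearD linearZ /= theta1 scaler0 add0r.
  rewrite linear_sum mulr_sumr; apply: eq_bigr => k _.
  rewrite linearZ /= theta_exp /= -mulrA mulr_natl -scaler_nat.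
  rewrite scalerA factS natrM invfM mulrAC mulVf // mul1r -scalerAr.
  by congr (_ *: _); rewrite mulrC.
apply: fpsP => n; rewrite (@fps_coefM_local _ _ (theta S) _ (E n.+1)) //.
  by rewrite -dE !fps_coef_theta (coefE n n.+1).
by move=> i; exact: coefE.
Qed.

End Euler.

(** * Splitting exponents modulo p *)

Section Sections.
Variables (K : fieldType) (p : nat).
Hypothesis p_gt0 : (0 < p)%N.
Implicit Types F G H : fps K.

(** With [Y = X^p], a series in [X] is the sum over [j < p] of [X^j] times its
    [j]-th section evaluated at [Y]; an equation in [X] thereby becomes [p] coupled
    equations in [Y]. *)
Definition fps_section j F : fps K := FPS (fun n => fps_coef F (n * p + j)%N).

Lemma fps_coef_section j F n :
  fps_coef (fps_section j F) n = fps_coef F (n * p + j)%N.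
Proof. by []. Qed.

Lemma fps_coef_subst F n :
  fps_coef (fps_subst_p p F) n = if (p %| n)%N then fps_coef F (n %/ p)%N else 0.
Proof. by []. Qed.

Lemma fps_sectionD j F G :
  fps_section j (F + G) = fps_section j F + fps_section j G.
Proof. exact: fpsP. Qed.

Lemma fps_section_X F j : fps_section j.+1 (fps_X K * F) = fps_section j F.
Proof. by apply: fpsP => n; rewrite !fps_coef_section addnS coef_fps_XM. Qed.

Lemma fps_section_X0 F :
  fps_section 0 (fps_X K * F) = fps_X K * fps_section p.-1 F.
Proof.
apply: fpsP => n; rewrite coef_fps_XM fps_coef_section coef_fps_XM addn0.
case: n => [|n] //.
by rewrite fps_coef_section mulSn -{1}(prednK p_gt0) addSn addnC.
Qed.

Lemma fps_section_theta F j :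
  fps_section j (theta F)
    = p%:R * theta (fps_section j F) + j%:R * fps_section j F.
Proof.
apply: fpsP => n; rewrite fps_coefD !mulr_natl -!scaler_nat !fps_coefZ.
by rewrite /= natrD natrM mulrDl mulrA [p%:R * _]mulrC.
Qed.

Lemma fps_sectionP F G :
  (forall j, (j < p)%N -> fps_section j F = fps_section j G) -> F = G.
Proof.
move=> eFG; apply: fpsP => n; have := eFG _ (ltn_pmod n p_gt0).
by move=> /(congr1 (fun H => fps_coef H (n %/ p)%N)); rewrite /= -divn_eq.
Qed.

Lemma fps_subst_head_tail F :
  fps_subst_p p F
    = fps_coef F 0 *: 1 + fps_X K ^+ p * fps_subst_p p (fps_shift 1 F).
Proof.
apply: fpsP => n; rewrite fps_coefD fps_coefZ fps_coef1 coef_fps_XnM.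
rewrite !fps_coef_subst.
case: ltnP => [lt_np|le_pn].
  rewrite addr0; case: n lt_np => [|n] lt_np; first by rewrite dvdn0 div0n mulr1.
  by rewrite gtnNdvd // mulr0.
have n_gt0 : (0 < n)%N := leq_trans p_gt0 le_pn.
rewrite eqn0Ngt n_gt0 mulr0 add0r -{1 2}(subnK le_pn) dvdn_addl //.
by rewrite divnDr // divnn p_gt0 addn1.
Qed.

(** Series in [X^p] are the scalars for the decomposition into sections. *)
Lemma fps_section_subst G F j : (j < p)%N ->
  fps_section j (fps_subst_p p G * F) = G * fps_section j F.
Proof.
move=> lt_jp; apply: fpsP => n; elim: n G => [|n IH] G.
  rewrite fps_coefM0 !(fps_coef_section j) mul0n add0n fps_subst_head_tail.
  rewrite mulrDl -scalerAl mul1r -mulrA fps_coefD coef_fps_XnM lt_jp addr0.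
  by rewrite fps_coefZ.
rewrite {2}[G]fps_head_tail fps_subst_head_tail !mulrDl -!scalerAl.
rewrite !mul1r -!mulrA fps_coefD coef_fps_XM -IH.
rewrite !fps_coef_section fps_coefD coef_fps_XnM !fps_coefZ.
by rewrite fps_coef_section mulSn -addnA ltnNge leq_addr addKn.
Qed.

Lemma fps_substM G F :
  fps_subst_p p (G * F) = fps_subst_p p G * fps_subst_p p F.
Proof.
have sec_subst H j : (j < p)%N ->
    fps_section j (fps_subst_p p H) = if j == 0%N then H else 0.
  move=> lt_jp; apply: fpsP => n /=; rewrite dvdn_addr ?dvdn_mull //.
  case: j lt_jp => [|j] lt_jp; first by rewrite dvdn0 addn0 mulnK.
  by rewrite gtnNdvd //= ; case: (n == _).
apply: fps_sectionP => j lt_jp; rewrite fps_section_subst // !sec_subst //.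
by case: eqP => _; rewrite ?mulr0.
Qed.

Lemma theta_fps_subst F :
  theta (fps_subst_p p F) = p%:R * fps_subst_p p (theta F).
Proof.
apply: fpsP => n; rewrite mulr_natl -scaler_nat fps_coefZ !fps_coef_theta.
rewrite !fps_coef_subst fps_coef_theta; case: ifP => [/divnK {1}<-|_].
  by rewrite natrM mulrA [p%:R * _]mulrC.
by rewrite !mulr0.
Qed.

End Sections.

(** * Polynomials in the operators T_H *)

Section Operators.
Variables (K : fieldType) (p : nat).
Implicit Types F G H : fps K.

Lemma op_poly_cut (P : {poly K}) (T : fps K -> fps K) G n : (size P <= n)%N ->
  op_poly P T G = \sum_(i < n) P`_i *: iter i T G.
Proof.
move=> le_Pn; rewrite /op_poly (big_ord_widen n (fun i => P`_i *: iter i T G)) //.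
rewrite big_mkcond; apply: eq_bigr => i _; case: ifP => // /negbT.
by rewrite -leqNgt => /(nth_default 0) ->; rewrite scale0r.
Qed.

Lemma op_polyD P Q (T : fps K -> fps K) G :
  op_poly (P + Q) T G = op_poly P T G + op_poly Q T G.
Proof.
have le_max := size_polyD P Q.
rewrite (op_poly_cut _ _ le_max) (op_poly_cut _ _ (leq_maxl _ (size Q))).
rewrite (op_poly_cut _ _ (leq_maxr (size P) _)) -big_split.
by apply: eq_bigr => i _; rewrite coefD scalerDl.
Qed.

Lemma op_polyZ c P (T : fps K -> fps K) G :
  op_poly (c *: P) T G = c *: op_poly P T G.
Proof.
rewrite (op_poly_cut _ _ (size_scale_leq c P)) /op_poly scaler_sumr.
by apply: eq_bigr => i _; rewrite coefZ scalerA.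
Qed.

Lemma op_polyXn n (T : fps K -> fps K) G : op_poly 'X^n T G = iter n T G.
Proof.
rewrite /op_poly size_polyXn big_ord_recr /= coefXn eqxx scale1r big1 ?add0r //.
by move=> i _; rewrite coefXn ltn_eqF // scale0r.
Qed.

(** Evaluation at [T] is multiplicative although [op_poly] is defined
    coefficientwise; linearity of [T] lets it cross the sum. *)
Lemma op_polyM_XsubC P c (T : {linear fps K -> fps K}) G :
  op_poly (P * ('X - c%:P)) T G = T (op_poly P T G) - c *: op_poly P T G.
Proof.
have leP : (size (P * ('X - c%:P))%R <= (size P).+1)%N.
  by apply: leq_trans (size_polyMleq _ _) _; rewrite size_XsubC addn2.
rewrite (op_poly_cut _ _ leP) mulrBr; under eq_bigr do rewrite coefB scalerBl.
rewrite sumrB big_ord_recl coefMX scale0r add0r; congr (_ + _).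
  rewrite /op_poly linear_sum.
  by apply: eq_bigr => i _; rewrite coefMX linearZ.
rewrite (op_poly_cut _ _ (leqnSn _)) scaler_sumr.
by congr (- _); apply: eq_bigr => i _; rewrite coefMC scalerA mulrC.
Qed.

Lemma iter_op_mul h n G : iter n (op_mul h) G = h ^+ n * G.
Proof. by elim: n => [|n IH] /=; rewrite ?mul1r // IH /op_mul mulrA exprS. Qed.

Lemma horner_alg_op_poly (P : {poly K}) h G :
  horner_alg h P * G = op_poly P (op_mul h) G.
Proof.
rewrite -{1}[P]coefK poly_def linear_sum mulr_suml; apply: eq_bigr => i _.
by rewrite linearZ /= rmorphXn /= horner_algX iter_op_mul -scalerAl mul1r scalerAl.
Qed.

Lemma op_T_is_linear H : linear (op_T p H).
Proof.
move=> a F G; rewrite /op_T /op_E /op_mul linearP !mulrDr -!scalerAr !scalerDr.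
rewrite !scalerA ![p%:R * _]mulrC -!scalerA; ring.
Qed.
HB.instance Definition _ H :=
  GRing.isLinear.Build K (fps K) (fps K) _ (op_T p H) (@op_T_is_linear H).

Lemma op_TE H G : op_T p H G = f_series K p * G + p%:R * op_E H G.
Proof. by rewrite /op_T /op_mul scaler_nat mulr_natl. Qed.

Lemma op_TB H F G : op_T p H (F - G) = op_T p H F - op_T p H G.
Proof. exact: raddfB. Qed.

Lemma op_ED H F G : op_E H (F + G) = op_E H F + op_E H G.
Proof. rewrite /op_E /op_mul thetaD; ring. Qed.

Lemma op_EM H F G : op_E H (F * G) = theta F * G + F * op_E H G.
Proof. rewrite /op_E /op_mul thetaM; ring. Qed.

Lemma op_T_sub H H' F G :
  op_T p H F - op_T p H' G
    = f_series K p * (F - G) + p%:R * op_E H (F - G) + p%:R * ((H - H') * G).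
Proof.
rewrite !op_TE op_ED /op_E /op_mul -[- G]scaleN1r thetaZ !scaleN1r; ring.
Qed.

Lemma theta_nat n : theta n%:R = 0 :> fps K.
Proof. by rewrite -[n%:R]mulr1 mulr_natl -scaler_nat thetaZ theta1 scaler0. Qed.

Lemma op_E_natM H n G : op_E H (n%:R * G) = n%:R * op_E H G.
Proof. by rewrite op_EM theta_nat mul0r add0r. Qed.

Lemma op_Q_sub H H' G :
  op_Q p H G - op_Q p H' G
    = (p ^ 2)%N%:R^-1 *: (iter p (op_T p H) G - iter p (op_T p H') G).
Proof. by rewrite /op_Q -scalerBr opprB addrA subrK. Qed.

Lemma op_V_sub H H' G :
  op_V p H G - op_V p H' G
    = p%:R^-1 *: \sum_(i < size (Phi K p))
        (Phi K p)`_i *: (iter i (op_T p H) G - iter i (op_T p H') G).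
Proof.
rewrite /op_V -scalerBr opprB addrA subrK -sumrB.
by congr (_ *: _); apply: eq_bigr => i _; rewrite scalerBr.
Qed.

Lemma op_VE H G :
  op_V p H G = p%:R^-1 *: \sum_(i < size (Phi K p))
    (Phi K p)`_i *: (iter i (op_T p H) G - f_series K p ^+ i * G).
Proof.
rewrite /op_V /op_mul horner_alg_op_poly -sumrB.
by congr (_ *: _); apply: eq_bigr => i _; rewrite iter_op_mul scalerBr.
Qed.

(** The sum of the [f^i E f^(n-1-i)] for [i < n], applied to [G], with each [E]
    moved to the right by means of [E f = f E + theta f].  It is the coefficient
    of [p] in [(f + pE)^n]. *)
Definition op_T_first_order H G n : fps K :=
  n%:R * f_series K p ^+ n.-1 * op_E H G
  + 'C(n, 2)%:R * f_series K p ^+ n.-2 * theta (f_series K p) * G.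

Lemma op_T_first_order0 H G : op_T_first_order H G 0 = 0.
Proof. by rewrite /op_T_first_order !mul0r addr0. Qed.

Lemma op_T_first_order_step H G n :
  op_T p H (f_series K p ^+ n * G + p%:R * op_T_first_order H G n)
    = f_series K p ^+ n.+1 * G + p%:R * op_T_first_order H G n.+1
      + p%:R * (p%:R * op_E H (op_T_first_order H G n)).
Proof.
rewrite op_TE op_ED op_E_natM op_EM theta_exp.
set E := op_E H (op_T_first_order _ _ _); rewrite /op_T_first_order binS bin1.
have fn : n%:R * f_series K p ^+ n = n%:R * (f_series K p * f_series K p ^+ n.-1).
  by case: n {E} => [|n]; rewrite ?mul0r // exprS.
have fn1 : 'C(n, 2)%:R * f_series K p ^+ n.-1
    = 'C(n, 2)%:R * (f_series K p * f_series K p ^+ n.-2).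
  by case: n {E fn} => [|[|n]]; rewrite ?mul0r // exprS.
rewrite !natrD /= exprS.
set f := f_series K p in fn fn1 *; set c := 'C(n, 2)%:R in fn1 *.
transitivity (f * f ^+ n * G
   + p%:R * ((n%:R * (f * f ^+ n.-1)) * op_E H G + n%:R * f ^+ n.-1 * theta f * G
     + f ^+ n * op_E H G + (c * (f * f ^+ n.-2)) * theta f * G)
   + p%:R * (p%:R * E)); first by ring.
by rewrite -fn1 -fn -natr1; ring.
Qed.

(** The first order effect on [T_H^n G] of replacing [H'] by [H]: the operators
    differ by multiplication by [p (H - H')], and modulo [p] they are both
    multiplication by [f]. *)
Definition op_T_variation H H' G n : fps K :=
  p%:R * (n%:R * (f_series K p ^+ n.-1 * ((H - H') * G))).

Lemma op_T_variation0 H H' G : op_T_variation H H' G 0 = 0.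
Proof. by rewrite /op_T_variation mul0r mulr0. Qed.

Lemma op_T_variation_step H H' F F' G n :
  op_T p H F - op_T p H' F' - op_T_variation H H' G n.+1
    = f_series K p * (F - F' - op_T_variation H H' G n) + p%:R * op_E H (F - F')
      + p%:R * ((H - H') * (F' - f_series K p ^+ n * G)).
Proof.
rewrite op_T_sub /op_T_variation -natr1; set E := op_E _ _.
have fn : n%:R * f_series K p ^+ n = n%:R * (f_series K p * f_series K p ^+ n.-1).
  by case: n => [|n]; rewrite ?mul0r // exprS.
rewrite [n.+1.-1]/= [(_ + 1) * _]mulrDl mul1r mulrA.
rewrite [n%:R * (_ * _)]mulrA fn; ring.
Qed.

End Operators.

(** * The equations satisfied by AH, C and L *)

Section FunctionalEquation.
Variables (K : fieldType) (p : nat).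
Hypothesis p_gt1 : (1 < p)%N.
Hypothesis char0 : forall n, n.+1%:R != 0 :> K.
Let p_gt0 : (0 < p)%N := ltnW p_gt1.
Local Notation q := (q_series K p).
Local Notation X := (fps_X K).
Local Notation AH := (artin_hasse K p).
Local Notation C := (C_series K p).
Local Notation L := (L_series K p).

(** The summation range depends on the degree; any longer range will do, because
    [i < p ^ i]. *)
Lemma q_series_cut n N : (n <= N)%N ->
  fps_coef q n = \sum_(i < N.+1 | n == (p ^ i)%N) 1.
Proof.
move=> le_nN; rewrite [LHS]/=.
rewrite (big_ord_widen_cond N.+1 (fun i => n == p ^ i)%N (fun=> 1)) //.
apply: eq_bigl => i; case: eqP => //= ->.
by rewrite ltnS ltnW // ltn_expl.
Qed.

Lemma q_series0 : fps_coef q 0 = 0.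
Proof. by rewrite /= big1 // => i; rewrite ltn_eqF // expn_gt0 p_gt0. Qed.

Lemma q_series_functional : q = X + fps_subst_p p q.
Proof.
apply: fpsP => -[|n]; rewrite fps_coefD fps_coef_subst.
  by rewrite dvdn0 div0n q_series0 addr0.
rewrite (q_series_cut (leqnn _)) [LHS]big_mkcond [LHS]big_ord_recl -big_mkcond.
congr (_ + _); first by rewrite [RHS]/= -[in LHS]mulrb.
case: ifP => [/dvdnP[m def_n]|ndvd]; last first.
  rewrite big1 // => i /eqP def_n.
  by rewrite def_n lift0 expnS dvdn_mulr in ndvd.
have m_gt0 : (0 < m)%N by case: m def_n => //; rewrite mul0n.
have le_mn : (m <= n)%N by rewrite -ltnS def_n -{1}[m]muln1 ltn_pmul2l.
rewrite [in RHS]def_n mulnK //.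
transitivity (fps_coef q m); last by [].
rewrite (q_series_cut le_mn).
by apply: eq_bigl => i; rewrite lift0; move: (val i) => j;
   rewrite def_n expnSr eqn_pmul2r.
Qed.

Lemma theta_artin_hasse : theta AH = q * AH.
Proof.
rewrite theta_fps_exp //.
  congr (_ * _); apply: fpsP => n; rewrite fps_coef_theta /= mulr_sumr.
  apply: eq_bigr => i /eqP {1}->; rewrite divff //.
  by rewrite -(prednK (_ : 0 < p ^ i)%N) ?expn_gt0 ?p_gt0 ?char0.
by rewrite /= big1 // => i; rewrite ltn_eqF // expn_gt0 p_gt0.
Qed.

Lemma artin_hasse0 : fps_coef AH 0 = 1.
Proof. by rewrite /= big_ord1 expr0 divr1. Qed.

Definition exp_pX : fps K := FPS (fun n => (p ^ n)%N%:R / n`!%:R).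

Lemma theta_exp_pX : theta exp_pX = p%:R * fps_X K * exp_pX.
Proof.
apply: fpsP => n; rewrite -mulrA mulr_natl -scaler_nat fps_coefZ coef_fps_XM.
rewrite fps_coef_theta; case: n => [|n]; first by rewrite mul0r mulr0.
rewrite /= factS expnS !natrM invfM.
rewrite [RHS]mulrA mulrCA [n.+1%:R * _]mulrCA mulrA.
by rewrite mulrA divfK.
Qed.

(** Both sides have constant term [1] and logarithmic derivative [p q]: on the
    right, [p q(X^p)] comes from [AH(X^p)] and [p X] from [exp(pX)]. *)
Lemma artin_hasse_dwork : AH ^+ p = fps_subst_p p AH * exp_pX.
Proof.
have q0 := q_series0.
apply: (@theta_linear_uniq _ char0 (p%:R * q)).
- by rewrite fps_coefM0 q0 mulr0.
- by rewrite fps_coefX0 fps_coefM0 fps_coef_subst dvdn0 div0n artin_hasse0 expr1n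
     /= expn0 fact0 divr1 mulr1.
- rewrite theta_exp theta_artin_hasse.
  have -> : AH ^+ p = AH * AH ^+ p.-1 by rewrite -exprS prednK.
  by ring.
rewrite thetaM theta_exp_pX theta_fps_subst // theta_artin_hasse //.
by rewrite fps_substM // {2}q_series_functional; ring.
Qed.

Lemma C_series_section : C = fps_section p 0 AH.
Proof. by apply: fpsP => n; rewrite fps_coef_section addn0. Qed.

Lemma C_series_unit : C \is a GRing.unit.
Proof.
have C0 : fps_coef C 0 = 1 by rewrite -artin_hasse0.
by have [G GC] := fps_has_inverse C0; apply/unitrPr; exists G; rewrite mulrC.
Qed.

(** The section of degree [j] of [theta AH = X AH + q(X^p) AH]. *)
Lemma section_artin_hasse_rec j : (0 < j < p)%N ->
  p%:R * theta (fps_section p j AH) + j%:R * fps_section p j AH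
    = fps_section p j.-1 AH + q * fps_section p j AH.
Proof.
case: j => [|j] // /andP[_ lt_jp]; rewrite -fps_section_theta theta_artin_hasse.
rewrite {1}q_series_functional mulrDl fps_sectionD fps_section_X.
by rewrite fps_section_subst.
Qed.

(** For [j = 0], multiplication by [X] wraps around and produces a factor [Y]. *)
Lemma section_artin_hasse_rec0 :
  p%:R * theta C = X * fps_section p p.-1 AH + q * C.
Proof.
rewrite C_series_section -fps_section_X0 // -fps_section_subst // -fps_sectionD.
rewrite -mulrDl -q_series_functional -theta_artin_hasse fps_section_theta.
by rewrite mul0r addr0.
Qed.

(** Conjugation by [C] turns [theta] into [theta + L]. *)
Lemma C_series_conj U : C * op_T p L U = p%:R * theta (C * U) - q * (C * U).
Proof.
have CL : C * L = theta C by rewrite mulrC divrK // C_series_unit.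
rewrite /op_T /op_E /op_mul /f_series scaler_nat -mulr_natl thetaM -CL; ring.
Qed.

(** Each factor [T - k] with [0 < k] moves one step down the chain of sections:
    [(T - k) Y A_(p-k) = Y (T + p - k) A_(p-k) = Y A_(p-k-1)].  The factor [T]
    starts the chain at [Y A_(p-1)]. *)
Lemma C_series_falling k : (k < p)%N ->
  C * op_poly (\prod_(i < k.+1) ('X - (i%:R)%:P)) (op_T p L) 1
    = X * fps_section p (p - k.+1) AH.
Proof.
elim: k => [|k IH] lt_kp.
  rewrite big_ord1 -['X - _]mul1r op_polyM_XsubC scale0r subr0.
  rewrite -(expr0 'X) op_polyXn /= C_series_conj mulr1 section_artin_hasse_rec0.
  by rewrite addrK subn1.
rewrite big_ord_recr /= op_polyM_XsubC mulrBr C_series_conj -scalerAr.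
rewrite IH 1?ltnW //.
have j_gt0 : (0 < p - k.+1 < p)%N by rewrite subn_gt0 lt_kp ltn_subrL.
have := section_artin_hasse_rec j_gt0; rewrite -subnS.
set B := fps_section p (p - k.+2) AH; set A := fps_section _ _ _ => recA.
(* [theta (X * A)] produces the shift of [T] by [p] as it crosses [X]. *)
rewrite thetaM theta_fps_X scaler_nat -mulr_natl.
have -> : B = p%:R * theta A + (p - k.+1)%:R * A - q * A by rewrite recA addrK.
rewrite natrB 1?ltnW //; ring.
Qed.

Lemma falling_op_T_L : op_poly (falling_poly K p) (op_T p L) 1 = X.
Proof.
apply: (mulrI C_series_unit); have := @C_series_falling p.-1.
by rewrite (prednK p_gt0) subnn -C_series_section [X * _]mulrC => ->.
Qed.

Lemma L_series_fixed_point : odd p ->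
  L = L0_series K p + p%:R *: calT p L.
Proof.
move=> p_odd.
have pn0 : p%:R != 0 :> K by rewrite -(prednK p_gt0).
pose T := op_T p L.
have eqX : X = iter p T 1 - T 1 + p%:R *: op_poly (Phi K p) T 1.
  rewrite -falling_op_T_L.
  have -> : falling_poly K p = 'X^p + (-1) *: 'X^1 + p%:R *: Phi K p.
    by rewrite /Phi scalerA divff // scale1r scaleN1r expr1; ring.
  by rewrite !op_polyD !op_polyZ !op_polyXn scaleN1r.
have T1 : T 1 = - q + p%:R *: L.
  by rewrite /T /op_T /op_E /op_mul theta1 add0r !mulr1.
have qX := q_series_functional.
apply: (scalerI pn0); rewrite /calT /op_Q /op_V /L0_series /D_series.
rewrite /op_mul iter_op_mul !mulr1 /f_series exprNn -signr_odd p_odd expr1 mulN1r.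
rewrite -/T natrX; rewrite T1 qX in eqX.
have pL : p%:R *: L = iter p T 1 + fps_subst_p p q + p%:R *: op_poly (Phi K p) T 1.
  by apply: (addrI X); rewrite {1}eqX; ring.
have pp : p%:R * p%:R * p%:R ^- 2 = 1 :> K by rewrite divff // mulf_neq0.
have p1 : p%:R * p%:R^-1 = 1 :> K by rewrite divff.
rewrite pL !(scalerDr, scalerN, scalerA) p1 pp mulfK //.
rewrite !(scaleN1r, scale1r); ring.
Qed.
End FunctionalEquation.

(** * p-adic integers *)

Section PadicIntegers.
Variables (p : nat) (p_pr : prime p).
Local Notation Zp := (padic_int p_pr).
Local Notation K := (padic p_pr).
Implicit Types (x y : Zp) (m n r s : nat).

Let pX_gt0 n : (0 < p ^ n)%N.
Proof. by rewrite expn_gt0 prime_gt0. Qed.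

Lemma residue_natr m n : residue (m%:R : Zp) n = (m %% p ^ n)%N.
Proof.
elim: m => [|m IH] //; rewrite -natr1 [LHS]/= IH.
by rewrite modnDml modnDmr addn1.
Qed.

Lemma padic_int_natr_neq0 n : n.+1%:R != 0 :> Zp.
Proof.
apply/eqP => /(congr1 (fun x => residue x n.+1)).
rewrite residue_natr /= mod0n modn_small //.
by rewrite ltn_expl ?prime_gt1.
Qed.

Lemma padic_natr_neq0 n : (0 < n)%N -> n%:R != 0 :> K.
Proof.
case: n => // n _.
by rewrite -(rmorph_nat (@tofrac Zp)) tofrac_eq0 padic_int_natr_neq0.
Qed.

(** The quotient by [p] is read off by shifting: its residue modulo [p^n] is
    one [p]-th of the residue of [x] modulo [p^(n+1)]. *)
Lemma padic_int_dvdp x : residue x 1 = 0%N -> exists y, x = p%:R * y.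
Proof.
move=> x1; have p_gt0 := prime_gt0 p_pr.
have dvd_x n : (p %| residue x n.+1)%N.
  by have := residue_dvd x 1 n; rewrite expn1 x1 eqxx add1n.
have compat n : (residue x n.+2 %/ p = residue x n.+1 %/ p %[mod p ^ n])%N.
  apply/eqP; rewrite -(eqn_pmul2r p_gt0) !muln_modl // -expnSr.
  by rewrite !divnK // residue_compat modn_residue.
exists (padic_mk p_pr compat); apply: padic_intP => n.
rewrite [in RHS]/= -/(residue (p%:R : Zp) n) residue_natr modn_mod modnMml modnMmr.
by rewrite mulnC divnK // residue_compat modn_residue.
Qed.

(** The inverses of [m] modulo the powers of [p], given by the Euclidean
    algorithm, are compatible because an inverse is unique. *)
Lemma padic_int_natr_unit m : coprime m p -> exists y : Zp, m%:R * y = 1.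
Proof.
move=> co_mp.
have m_gt0 : (0 < m)%N.
  by case: m co_mp => //; rewrite /coprime gcd0n gtn_eqF ?prime_gt1.
pose v n := (egcdn m (p ^ n)).1.
have vE n : (m * v n = 1 %[mod p ^ n])%N.
  rewrite /v; case: egcdnP => //= km kn def_km _.
  by rewrite mulnC def_km (eqP (coprimeXr n co_mp)) modnMDl.
have compat n : (v n.+1 = v n %[mod p ^ n])%N.
  have vS : (m * v n.+1 = 1 %[mod p ^ n])%N.
    have := congr1 (modn^~ (p ^ n)%N) (vE n.+1).
    by rewrite !modn_dvdm // dvdn_exp2l.

  rewrite -[v n.+1]muln1 -modnMmr -(vE n) modnMmr mulnA [(_ * m)%N]mulnC.
  by rewrite -modnMml vS modnMml mul1n.
exists (padic_mk p_pr compat); apply: padic_intP => n.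
rewrite [LHS]/= -/(residue (m%:R : Zp) n) residue_natr modn_mod modnMml modnMmr.
by rewrite vE /= modn_mod.
Qed.

Lemma residueX x m n : residue (x ^+ m) n = (residue x n ^ m %% p ^ n)%N.
Proof.
elim: m => [|m IH]; first by rewrite expr0 -[1]/(1%:R) residue_natr.
by rewrite exprS [LHS]/= IH modnMmr -expnS.
Qed.

(** Modulo [p] this is Fermat's little theorem for the first residue. *)
Lemma padic_int_fermat x : exists y, x ^+ p - x = p%:R * y.
Proof.
apply: padic_int_dvdp; rewrite [LHS]/= -/(residue (x ^+ p) 1) residueX.
rewrite modnDml modnDmr expn1 -modnDml fermat_little // modnDml.
by rewrite subnKC ?modnn // -modn_residue expn1 ltnW // ltn_mod prime_gt0.
Qed.

(** The case [r = 0] is integrality, so that integral elements and congruences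
    form one family, whose exponents add up in products. *)
Definition pdvd r (x : K) := exists z : Zp, x = (p ^ r)%N%:R * tofrac z.

Lemma pdvd0P (x : K) : pdvd 0 x <-> exists z : Zp, x = tofrac z.
Proof. by split=> -[z ->]; exists z; rewrite mul1r. Qed.

Lemma pdvd_tofrac (z : Zp) : pdvd 0 (tofrac z).
Proof. by exists z; rewrite mul1r. Qed.

Lemma pdvd_nat m : pdvd 0 m%:R.
Proof. by rewrite -(rmorph_nat (@tofrac Zp)); apply: pdvd_tofrac. Qed.

Lemma pdvd_zero r : pdvd r 0.
Proof. by exists 0; rewrite rmorph0 mulr0. Qed.

Lemma pdvdD r (a b : K) : pdvd r a -> pdvd r b -> pdvd r (a + b).
Proof. by move=> [x ->] [y ->]; exists (x + y); rewrite rmorphD mulrDr. Qed.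

Lemma pdvdN r (a : K) : pdvd r a -> pdvd r (- a).
Proof. by move=> [x ->]; exists (- x); rewrite rmorphN mulrN. Qed.

Lemma pdvdB r (a b : K) : pdvd r a -> pdvd r b -> pdvd r (a - b).
Proof. by move=> ra rb; apply: pdvdD => //; exact: pdvdN. Qed.

Lemma pdvdM r s (a b : K) : pdvd r a -> pdvd s b -> pdvd (r + s) (a * b).
Proof.
by move=> [x ->] [y ->]; exists (x * y); rewrite rmorphM expnD natrM /=; ring.
Qed.

Lemma pdvd_sum I (rs : seq I) (P : pred I) (F : I -> K) r :
  (forall i, P i -> pdvd r (F i)) -> pdvd r (\sum_(i <- rs | P i) F i).
Proof. by move=> rF; elim/big_ind: _ => //; [exact: pdvd_zero | exact: pdvdD]. Qed.

Lemma pdvd_prime : pdvd 1 p%:R.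
Proof. by exists 1; rewrite expn1 rmorph1 mulr1. Qed.

Lemma pdvd_le r s (a : K) : (s <= r)%N -> pdvd r a -> pdvd s a.
Proof.
move=> /subnKC <- [x ->]; exists ((p ^ (r - s))%N%:R * x).
by rewrite rmorphM rmorph_nat expnD natrM mulrA.
Qed.

Lemma pdvd_expn_mul r s (a : K) : pdvd (r + s) ((p ^ s)%N%:R * a) <-> pdvd r a.
Proof.
have ps_neq0 : (p ^ s)%N%:R != 0 :> K by apply: padic_natr_neq0.
split=> -[z az]; exists z.
  by apply: (mulfI ps_neq0); rewrite az addnC expnD natrM mulrA.
by rewrite az addnC expnD natrM mulrA.
Qed.

Lemma pdvd_coprime_inv m : coprime m p -> pdvd 0 (m%:R^-1 : K).
Proof.
move=> /padic_int_natr_unit[y my1]; apply/pdvd0P; exists y.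
apply: mulr1_eq.
by rewrite -(rmorph_nat (@tofrac Zp)) -rmorphM my1 rmorph1.
Qed.

(** The terms of Legendre's formula at least halve at each step.  The bound by [n]
    must be strict: this is where [exp(pX)] gains its factor [p]. *)
Lemma logn_fact_lt n : (0 < n)%N -> (logn p n`! < n)%N.
Proof.
move=> n_gt0; rewrite logn_fact // big_add1 /=.
(* The term [maxn 1 _] keeps one unit in reserve once the quotients vanish. *)
suff: (\sum_(0 <= k < n) n %/ p ^ k.+1 + maxn 1 (n %/ p ^ n) <= n)%N.
  by apply: leq_trans; rewrite -addn1 leq_add2l leq_maxl.
elim: {1 4}n => [|m IH].
  by rewrite big_geq // expn0 divn1 add0n geq_max n_gt0 leqnn.
apply: leq_trans IH; rewrite big_nat_recr //= -addnA leq_add2l expnSr divnMA.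
set a := (n %/ p ^ m)%N.
have le2 : (a %/ p * 2 <= a)%N.
  by apply: leq_trans (leq_trunc_div a p); rewrite leq_mul2l prime_gt1 ?orbT.
case: (posnP (a %/ p)%N) => [->|a_gt0]; first by rewrite add0n maxn0 leq_maxl.
by rewrite (maxn_idPr a_gt0) addnn -muln2 leq_max le2 orbT.
Qed.

(** Hence [exp(pX)] is congruent to [1] modulo [p]. *)
Lemma pdvd_fact_ratio n : (0 < n)%N -> pdvd 1 ((p ^ n)%N%:R / n`!%:R).
Proof.
move=> n_gt0; have [m co_pm n_fact] := pfactor_coprime p_pr (fact_gt0 n).
have lt_vn := logn_fact_lt n_gt0; set v := logn p n`! in n_fact lt_vn.
have pv_neq0 : (p ^ v)%N%:R != 0 :> K by apply: padic_natr_neq0.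
have -> : (p ^ n)%N%:R / n`!%:R = (p ^ (n - v))%N%:R * m%:R^-1 :> K.
  rewrite n_fact natrM invfM -{1}(subnK (ltnW lt_vn)) expnD natrM.
  by rewrite mulrACA divff // mulr1.
apply: (@pdvd_le (n - v + 0)); first by rewrite addn0 subn_gt0.
apply: pdvdM; first by exists 1; rewrite rmorph1 mulr1.
by apply: pdvd_coprime_inv; rewrite coprime_sym.
Qed.

End PadicIntegers.

(** * Power series divisible by a power of p *)

Lemma exprDn_middle (R : comPzRingType) (x y : R) n :
  (x + y) ^+ n.+1 - (x ^+ n.+1 + y ^+ n.+1)
    = \sum_(i < n) (x ^+ (n - i) * y ^+ i.+1) *+ 'C(n.+1, i.+1).
Proof.
rewrite exprDn big_ord_recl big_ord_recr /= subn0 expr0 mulr1 bin0 mulr1n.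
by rewrite /bump add1n subnn expr0 mul1r binn mulr1n addrCA addrK.
Qed.

Section PadicSeriesIdeal.
Variables (p : nat) (p_pr : prime p).
Local Notation K := (padic p_pr).
Implicit Types (F G : fps K) (m n r s : nat).

Definition fdvd r F := forall n, pdvd r (fps_coef F n).

Lemma fps_integralP F : fps_integral F <-> fdvd 0 F.
Proof. by split=> iF n; apply/pdvd0P. Qed.

Lemma fps_congrE r F G : fps_congr r F G = fdvd r (F - G).
Proof. by []. Qed.

Lemma fdvd0 r : fdvd r 0.
Proof. by move=> n /=; case: (n == 0%N); exact: pdvd_zero. Qed.

Lemma fdvd1 : fdvd 0 1.
Proof. by move=> n; rewrite fps_coef1; exact: pdvd_nat. Qed.

Lemma fdvdD r F G : fdvd r F -> fdvd r G -> fdvd r (F + G).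
Proof. by move=> rF rG n; exact: pdvdD. Qed.

Lemma fdvdN r F : fdvd r F -> fdvd r (- F).
Proof. by move=> rF n; exact: pdvdN. Qed.

Lemma fdvdB r F G : fdvd r F -> fdvd r G -> fdvd r (F - G).
Proof. by move=> rF rG n; exact: pdvdB. Qed.

Lemma fdvdM r s F G : fdvd r F -> fdvd s G -> fdvd (r + s) (F * G).
Proof. by move=> rF sG n; apply: pdvd_sum => i _; exact: pdvdM. Qed.

Lemma fdvd_mull r F G : fdvd 0 F -> fdvd r G -> fdvd r (F * G).
Proof. by move=> iF rG; rewrite -[r]add0n; exact: fdvdM. Qed.

Lemma fdvdX F n : fdvd 0 F -> fdvd 0 (F ^+ n).
Proof.
move=> iF; elim: n => [|n IH]; first exact: fdvd1.
by rewrite exprS; exact: fdvd_mull.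
Qed.

Lemma fdvdZ r s c F : pdvd r c -> fdvd s F -> fdvd (r + s) (c *: F).
Proof. by move=> rc sF n; exact: pdvdM. Qed.

Lemma fdvd_prime_mul r F : fdvd r F -> fdvd r.+1 (p%:R * F).
Proof. by rewrite mulr_natl -scaler_nat -add1n; apply: fdvdZ; exact: pdvd_prime. Qed.

Lemma fdvd_nat m : fdvd 0 m%:R.
Proof.
rewrite -[m%:R]mulr1 mulr_natl -scaler_nat; apply: (@fdvdZ 0 0) fdvd1.
exact: pdvd_nat.
Qed.

Lemma fdvd_dvdn m : (p %| m)%N -> fdvd 1 m%:R.
Proof.
move=> /dvdnP[k ->]; rewrite mulnC natrM.
by apply: fdvd_prime_mul; exact: fdvd_nat.
Qed.

Lemma fdvd_sum I (rs : seq I) (P : pred I) (F : I -> fps K) r :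
  (forall i, P i -> fdvd r (F i)) -> fdvd r (\sum_(i <- rs | P i) F i).
Proof. by move=> rF; elim/big_ind: _ => //; [exact: fdvd0 | exact: fdvdD]. Qed.

Lemma fdvd_le r s F : (s <= r)%N -> fdvd r F -> fdvd s F.
Proof. by move=> le_sr rF n; exact: pdvd_le (rF n). Qed.

Lemma fdvd_theta r F : fdvd r F -> fdvd r (theta F).
Proof. by move=> rF n; rewrite -[r]add0n; apply: pdvdM => //; exact: pdvd_nat. Qed.

Lemma fdvd_divp r s F : fdvd (r + s) F -> fdvd r ((p ^ s)%N%:R^-1 *: F).
Proof.
move=> rsF n; apply/(@pdvd_expn_mul _ p_pr r s).
rewrite fps_coefZ mulrA divff ?mul1r //.
by rewrite padic_natr_neq0 // expn_gt0 prime_gt0.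
Qed.

Lemma fdvd_divp1 r F : fdvd r.+1 F -> fdvd r (p%:R^-1 *: F).
Proof. by have := @fdvd_divp r 1 F; rewrite expn1 addn1. Qed.

(** Long division: the leading coefficient [1] of [F] makes each coefficient of
    [G] an integral combination of those of [F * G] and earlier ones. *)
Lemma fdvd_inverse F G :
  fps_coef F 0 = 1 -> fdvd 0 F -> fdvd 0 (F * G) -> fdvd 0 G.
Proof.
move=> F0 iF iFG n; elim/ltn_ind: n => n IH.
have := iFG n; rewrite fps_coefM big_ord_recl F0 mul1r subn0 => iFGn.
rewrite -[fps_coef G n](addrK (\sum_(i < n) fps_coef F (lift ord0 i) *
                fps_coef G (n - lift ord0 i))).
apply: pdvdB => //; apply: pdvd_sum => i _; rewrite -[0%N]addn0.
apply: pdvdM => //; apply: IH.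
by rewrite lift0 ltn_subrL (leq_ltn_trans _ (ltn_ord i)).
Qed.

Lemma fdvd_subst F : fdvd 0 F -> fdvd 0 (fps_subst_p p F).
Proof. by move=> iF n; rewrite fps_coef_subst; case: ifP => // _; exact: pdvd_zero. Qed.

Lemma fdvd_q_series : fdvd 0 (q_series K p).
Proof. by move=> n; apply: pdvd_sum => i _; exact: (pdvd_nat p_pr 1). Qed.

(** The binomial coefficients [(p choose i)] with [0 < i < p] are multiples of [p]. *)
Lemma fdvd_freshman F G :
  fdvd 0 F -> fdvd 0 G -> fdvd 1 ((F + G) ^+ p - (F ^+ p + G ^+ p)).
Proof.
move=> iF iG; have p_gt0 := prime_gt0 p_pr.
have := exprDn_middle F G p.-1; rewrite (prednK p_gt0) => ->.
apply: fdvd_sum => i _; rewrite -mulr_natr mulrC.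
apply: (@fdvdM 1 0); last by apply: fdvd_mull; exact: fdvdX.
by apply: fdvd_dvdn; apply: prime_dvd_bin => //=; rewrite -ltn_predRL.
Qed.

(** Induction on the degree through [F = c + X F1]: the constant is Fermat's
    theorem, and [X F1] contributes [X^p (F1^p - F1(X^p))], whose coefficient in
    degree [n] is one of lower degree for [F1]. *)
Lemma fdvd_frobenius F : fdvd 0 F -> fdvd 1 (F ^+ p - fps_subst_p p F).
Proof.
move=> iF n; elim/ltn_ind: n F iF => n IH F iF.
have p_gt0 := prime_gt0 p_pr.
set c := fps_coef F 0; pose F1 := fps_shift 1 F.
have ic : pdvd 0 c := iF 0%N.
have icZ : fdvd 0 (c *: 1 : fps K) := @fdvdZ 0 0 _ _ ic fdvd1.
have iF1 : fdvd 0 F1 by move=> i; exact: iF.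
have iX : fdvd 0 (fps_X K) by move=> i; exact: pdvd_nat.
rewrite [X in fps_coef X n](_ : _ =
     (F ^+ p - ((c *: 1) ^+ p + (fps_X K * F1) ^+ p)) + (c ^+ p - c) *: 1
     + fps_X K ^+ p * (F1 ^+ p - fps_subst_p p F1)); last first.
  rewrite (fps_subst_head_tail p_gt0 F) exprMn exprZn expr1n scalerBl -/c -/F1; ring.
apply: pdvdD; first apply: pdvdD.
- rewrite {1}[F]fps_head_tail -/c -/F1.
  by apply: fdvd_freshman => //; exact: fdvd_mull.
- apply: (@fdvdZ 1 0) fdvd1 _.
  have /pdvd0P[x ->] := ic; have [y xy] := padic_int_fermat x.
  by exists y; rewrite -rmorphXn -rmorphB /= xy rmorphM rmorph_nat expn1.
rewrite coef_fps_XnM; case: ltnP => [_|le_pn]; first exact: pdvd_zero.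
by apply: IH => //; rewrite ltn_subrL p_gt0 (leq_trans p_gt0).
Qed.

End PadicSeriesIdeal.

(** * Integrality of AH, C, L and L0 *)

Section Integrality.
Variables (p : nat) (p_pr : prime p).
Local Notation K := (padic p_pr).
Local Notation q := (q_series K p).
Local Notation AH := (artin_hasse K p).
Let p_gt0 : (0 < p)%N := prime_gt0 p_pr.
Let p_gt1 : (1 < p)%N := prime_gt1 p_pr.
Let char0 n : n.+1%:R != 0 :> K := padic_natr_neq0 p_pr (ltn0Sn n).
Hint Resolve p_gt0 p_gt1 char0 : core.
Implicit Types F G H : fps K.

(** Dwork's argument.  In degree [n > 0], [AH^p] contains the unknown coefficient
    [u_n] only through [p u_n], while [AH(X^p) exp(pX)] does not contain it at all;
    the remaining terms agree modulo [p] by [fdvd_frobenius]. *)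
Lemma fdvd_artin_hasse : fdvd 0 AH.
Proof.
move=> n; elim/ltn_ind: n => -[|n] IH.
  by rewrite artin_hasse0; exact: (pdvd_nat p_pr 1).
(* [A] is the part of AH known to be integral by induction. *)
pose A : fps K := FPS (fun i => if (i < n.+1)%N then fps_coef AH i else 0).
have coefA i : fps_coef A i = if (i < n.+1)%N then fps_coef AH i else 0 by [].
have iA : fdvd 0 A.
  by move=> i; rewrite coefA; case: ifP => [/IH|_] //; exact: pdvd_zero.
have defAH : AH = A + fps_X K ^+ n.+1 * fps_shift n.+1 AH.
  apply: fpsP => i; rewrite fps_coefD coef_fps_XnM coefA.
  by case: ltnP => [_|/subnKC]; rewrite ?addr0 // add0r /= => ->.
pose E' := p%:R^-1 *: ((exp_pX K p) - 1).
have iE' : fdvd 0 E'.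
  apply: fdvd_divp1 => i.
  rewrite fps_coefB fps_coef1; case: i => [|i]; last first.
    by rewrite subr0; apply: pdvd_fact_ratio.
  by rewrite [fps_coef _ _]/= expn0 fact0 divr1 subrr; exact: pdvd_zero.
have pn0 : p%:R != 0 :> K by exact: padic_natr_neq0.
have defE : (exp_pX K p) = 1 + p%:R * E'.
  by rewrite mulr_natl -scaler_nat scalerA divff // scale1r addrC subrK.
have pcoef : fps_coef (AH ^+ p) n.+1
    = fps_coef (fps_subst_p p A * (1 + p%:R * E')) n.+1.
  rewrite artin_hasse_dwork // -defE; apply: fps_coefM_local => // i le_in.
  rewrite !fps_coef_subst; case: ifP => // _; rewrite coefA.
  case: i le_in => [|i] le_in; first by rewrite div0n.
  by rewrite (leq_trans (ltn_Pdiv p_gt1 (ltn0Sn i))).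
have shift0 : fps_coef (fps_shift n.+1 AH) 0 = fps_coef AH n.+1.
  by rewrite -[in RHS](addn0 n.+1).
have A0 : fps_coef A 0 = 1 by rewrite coefA artin_hasse0.
have := fps_coef_expr_perturb (fps_shift n.+1 AH) p (ltn0Sn n) A0.
rewrite -defAH shift0 {}pcoef => pcoef.
apply/(@pdvd_expn_mul _ p_pr 0 1); rewrite expn1.
have -> : p%:R * fps_coef AH n.+1 =
    fps_coef (p%:R * (fps_subst_p p A * E') - (A ^+ p - fps_subst_p p A)) n.+1.
  apply: (addrI (fps_coef (A ^+ p) n.+1)); rewrite -pcoef -fps_coefD.
  by congr fps_coef; ring.
apply: (fdvdB (fdvd_prime_mul _) (fdvd_frobenius iA)).
by apply: fdvd_mull => //; exact: fdvd_subst.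
Qed.

Lemma fdvd_C_series : fdvd 0 (C_series K p).
Proof. by move=> n; exact: fdvd_artin_hasse. Qed.

Lemma fdvd_L_series : fdvd 0 (L_series K p).
Proof.
apply: (@fdvd_inverse _ _ (C_series K p)); first exact: artin_hasse0.
  exact: fdvd_C_series.
rewrite mulrC divrK ?C_series_unit //.
by apply: fdvd_theta; exact: fdvd_C_series.
Qed.

Lemma fdvd_D_series : fdvd 0 (D_series K p).
Proof.
apply: fdvd_divp1.
by apply: fdvd_frobenius; exact: fdvd_q_series.
Qed.

(** The elements of ['F_p] are the roots of ['X^p - 'X]. *)
Lemma prod_Fp : \prod_(j < p) ('X - (j%:R)%:P) = 'X^p - 'X :> {poly 'F_p}.
Proof.
have := finField_genPoly 'F_p; rewrite card_Fp // => ->.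
transitivity (\prod_(x : 'F_p) ('X - ((x : nat)%:R)%:P) : {poly 'F_p}).
  rewrite -!(big_mkord xpredT (fun j => 'X - (j%:R)%:P)).
  by rewrite Fp_cast.
by apply: eq_bigr => x _; rewrite natr_Zp.
Qed.

Lemma dvdz_Fp_eq0 (z : int) : z%:~R = 0 :> 'F_p -> exists k : int, z = p%:R * k.
Proof.
have natP n : n%:R = 0 :> 'F_p -> exists k : int, n%:R = p%:R * k.
  move=> /eqP; rewrite -(dvdn_pcharf (pchar_Fp p_pr)) => /dvdnP[k ->].
  by exists k%:R; rewrite natrM mulrC.
case: z => n; first by rewrite -pmulrn => /natP; rewrite natz.
rewrite NegzE mulrNz -pmulrn => /eqP; rewrite oppr_eq0 => /eqP/natP[k].
by rewrite natz => ->; exists (- k); rewrite mulrN.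
Qed.

(** The numerator of [Phi] comes from an integer polynomial that vanishes over
    ['F_p]. *)
Lemma pdvd_Phi i : pdvd 0 ((Phi K p)`_i : K).
Proof.
pose Q (R : comNzRingType) : {poly R} :=
  \prod_(j < p) ('X - (j%:R)%:P) - ('X^p - 'X).
have map_Q (R : comNzRingType) : map_poly intr (Q int) = Q R.
  rewrite /Q !rmorphB /= map_polyXn map_polyX rmorph_prod /=; congr (_ - _).
  by apply: eq_bigr => j _; rewrite rmorphB /= map_polyX map_polyC /= rmorph_nat.
have [k Qk] : exists k : int, (Q int)`_i = p%:R * k.
  apply: dvdz_Fp_eq0; rewrite -(coef_map (intr : int -> 'F_p)) map_Q /Q.
  by rewrite prod_Fp subrr coef0.
have -> : (Phi K p)`_i = k%:~R :> K.
  rewrite /Phi coefZ -/(Q K) -map_Q coef_map /= Qk intrM mulrz_nat mulKf //.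
  exact: padic_natr_neq0.
by rewrite -(rmorph_int (@tofrac (padic_int p_pr))); exact: pdvd_tofrac.
Qed.

Lemma fdvd_horner_Phi F : fdvd 0 F -> fdvd 0 (horner_alg F (Phi K p)).
Proof.
move=> iF; rewrite -[horner_alg _ _]mulr1 horner_alg_op_poly /op_poly.
apply: fdvd_sum => i _; rewrite iter_op_mul mulr1.
by apply: (@fdvdZ _ _ 0 0); [exact: pdvd_Phi | exact: fdvdX].
Qed.

Lemma fdvd_L0_series : fdvd 0 (L0_series K p).
Proof.
apply: fdvdB; last exact: fdvd_D_series.
by apply: fdvd_horner_Phi; apply: fdvdN; exact: fdvd_q_series.
Qed.

End Integrality.

(** * Divisibility of powers of T_H *)

Section Contraction.
Variables (p : nat) (p_pr : prime p).
Local Notation K := (padic p_pr).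
Local Notation f := (f_series K p).
Implicit Types F G H : fps K.

Lemma fdvd_f_series : fdvd 0 f.
Proof. by apply: fdvdN; exact: fdvd_q_series. Qed.

Lemma fdvd_op_E r H G : fdvd 0 H -> fdvd r G -> fdvd r (op_E H G).
Proof. by move=> iH rG; apply: fdvdD; [exact: fdvd_theta | exact: fdvd_mull]. Qed.

Lemma fdvd_op_T r H G : fdvd 0 H -> fdvd r G -> fdvd r (op_T p H G).
Proof.
move=> iH rG; rewrite op_TE; apply: fdvdD.
  by apply: fdvd_mull rG; exact: fdvd_f_series.
by apply: fdvd_le (leqnSn r) _; apply: fdvd_prime_mul; exact: fdvd_op_E.
Qed.

Lemma fdvd_first_order H G n : fdvd 0 H -> fdvd 0 G ->
  fdvd 0 (op_T_first_order p H G n).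
Proof.
move=> iH iG; have i_f := fdvd_f_series.
apply: fdvdD; last first.
  apply: fdvd_mull => //; apply: fdvd_mull; last exact: fdvd_theta.
  by apply: fdvd_mull; [exact: fdvd_nat | exact: fdvdX].
apply: fdvd_mull; last exact: fdvd_op_E.
by apply: fdvd_mull; [exact: fdvd_nat | exact: fdvdX].
Qed.

(** Passing from [n] to [n + 1] by [op_T_first_order_step] leaves only a remainder
    that carries two factors [p]. *)
Lemma iter_op_T_first_order H G n : fdvd 0 H -> fdvd 0 G ->
  fdvd 2 (iter n (op_T p H) G
           - (f ^+ n * G + p%:R * op_T_first_order p H G n)).
Proof.
move=> iH iG; elim: n => [|n IH].
  rewrite op_T_first_order0 expr0 mulr0 addr0 mul1r subrr; exact: fdvd0.
have stepE := op_T_first_order_step p H G n.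
set S := _ + _ in stepE IH; set S' := f ^+ n.+1 * G + _ in stepE *.
have -> : iter n.+1 (op_T p H) G - S' =
    op_T p H (iter n (op_T p H) G - S)
    + p%:R * (p%:R * op_E H (op_T_first_order p H G n)).
  by rewrite iterS op_TB stepE; ring.
apply: fdvdD; first exact: fdvd_op_T.
do 2! apply: fdvd_prime_mul.
by apply: fdvd_op_E => //; exact: fdvd_first_order.
Qed.

Lemma iter_op_T_mod_p H G n : fdvd 0 H -> fdvd 0 G ->
  fdvd 1 (iter n (op_T p H) G - f ^+ n * G).
Proof.
move=> iH iG; have := fdvd_le (leqnSn 1) (iter_op_T_first_order n iH iG).
rewrite opprD addrA => ex.
rewrite -[X in fdvd _ X](subrK (p%:R * op_T_first_order p H G n)).
by apply: fdvdD => //; apply: fdvd_prime_mul; exact: fdvd_first_order.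
Qed.

(** For [n = p] the first order coefficients are [p] and ['C(p, 2)]; the second
    is a multiple of [p] because [2 < p]. *)
Lemma iter_op_T_mod_p2 H G : odd p -> fdvd 0 H -> fdvd 0 G ->
  fdvd 2 (iter p (op_T p H) G - f ^+ p * G).
Proof.
move=> p_odd iH iG; have := iter_op_T_first_order p iH iG.
rewrite opprD addrA => ex.
rewrite -[X in fdvd _ X](subrK (p%:R * op_T_first_order p H G p)).
have i_f := fdvd_f_series.
apply: fdvdD => //; apply: fdvd_prime_mul; apply: fdvdD.
  apply: (@fdvdM _ _ 1 0); last exact: fdvd_op_E.
  by apply: (@fdvdM _ _ 1 0); [exact: fdvd_dvdn | exact: fdvdX].
apply: (@fdvdM _ _ 1 0) => //; apply: (@fdvdM _ _ 1 0); last exact: fdvd_theta.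
apply: (@fdvdM _ _ 1 0); last exact: fdvdX.
by apply: fdvd_dvdn; apply: prime_dvd_bin => //=; exact: odd_prime_gt2.
Qed.

Lemma fdvd_variation r H H' G n : fdvd 0 G -> fdvd r (H - H') ->
  fdvd r.+1 (op_T_variation p H H' G n).
Proof.
move=> iG rHH'; apply: fdvd_prime_mul; apply: fdvd_mull; first exact: fdvd_nat.
apply: fdvd_mull; first by apply: fdvdX; exact: fdvd_f_series.
by rewrite -[r]addn0; exact: fdvdM.
Qed.

(** By [op_T_variation_step], besides [f] times the previous error, two new errors
    arise: [p E] applied to a difference already divisible by [p^(r+1)], and
    [p (H - H')] times the error of [T_H' = f] modulo [p]. *)
Lemma iter_op_T_variation r H H' G n :
    fdvd 0 H -> fdvd 0 H' -> fdvd 0 G -> fdvd r (H - H') ->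
  fdvd r.+2 (iter n (op_T p H) G - iter n (op_T p H') G
             - op_T_variation p H H' G n).
Proof.
move=> iH iH' iG rHH'; elim: n => [|n IH].
  rewrite op_T_variation0 subr0 subrr; exact: fdvd0.
have rD : fdvd r.+1 (iter n (op_T p H) G - iter n (op_T p H') G).
  rewrite -[X in fdvd _ X](subrK (op_T_variation p H H' G n)).
  by apply: fdvdD; [apply: fdvd_le IH | exact: fdvd_variation].
rewrite !iterS op_T_variation_step; apply: fdvdD; first apply: fdvdD.
- by apply: fdvd_mull IH; exact: fdvd_f_series.
- by apply: fdvd_prime_mul; exact: fdvd_op_E.
apply: fdvd_prime_mul; rewrite -addn1; apply: fdvdM => //.
exact: iter_op_T_mod_p.
Qed.

Lemma fdvd_op_Q H G : odd p -> fdvd 0 H -> fdvd 0 G -> fdvd 0 (op_Q p H G).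
Proof.
move=> p_odd iH iG; rewrite /op_Q iter_op_mul; apply: (@fdvd_divp _ _ 0 2).
exact: iter_op_T_mod_p2.
Qed.

Lemma fdvd_op_V H G : fdvd 0 H -> fdvd 0 G -> fdvd 0 (op_V p H G).
Proof.
move=> iH iG; rewrite op_VE; apply: fdvd_divp1; apply: fdvd_sum => i _.
by apply: (@fdvdZ _ _ 0 1); [exact: pdvd_Phi | exact: iter_op_T_mod_p].
Qed.

Lemma fdvd_calT H : odd p -> fdvd 0 H -> fdvd 0 (calT p H).
Proof.
by move=> p_odd iH; apply: fdvdD; [apply: fdvd_op_Q | apply: fdvd_op_V];
   rewrite //; exact: fdvd1.
Qed.

(** [op_Q] divides by [p^2] and needs the variation modulo [p^(r+2)], where
    the factor [n = p] of its main term helps; [op_V] divides by [p] only. *)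
Lemma calT_lipschitz r H H' : fdvd 0 H -> fdvd 0 H' -> fdvd r (H - H') ->
  fdvd r (calT p H - calT p H').
Proof.
move=> iH iH' rHH'; have i1 := fdvd1 p_pr.
have var n := iter_op_T_variation n iH iH' i1 rHH'.
rewrite /calT opprD addrACA op_Q_sub op_V_sub; apply: fdvdD.
  apply: fdvd_divp; rewrite addn2.
  rewrite -[X in fdvd _ X](subrK (op_T_variation p H H' 1 p)).
  apply: fdvdD => //; apply: fdvd_prime_mul; apply: fdvd_prime_mul.
  apply: fdvd_mull; first by apply: fdvdX; exact: fdvd_f_series.
  by rewrite -[r]addn0; exact: fdvdM.
apply: fdvd_divp1; apply: fdvd_sum => i _.
apply: (@fdvdZ _ _ 0 r.+1); first exact: pdvd_Phi.
rewrite -[X in fdvd _ X](subrK (op_T_variation p H H' 1 i)).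
by apply: fdvdD; [exact: fdvd_le (var i) | exact: fdvd_variation].
Qed.

End Contraction.

Theorem theorem1p7 (p : nat) (p_pr : prime p) (p_odd : odd p) :
  let K := padic p_pr in
  let L : fps K := L_series K p in
  let L0 : fps K := L0_series K p in
  let T : fps K -> fps K := @calT K p in
  (* C, L, L_{0,p} are in Z_p[[Y]] *)
  (fps_integral (C_series K p) /\ fps_integral L /\ fps_integral L0) /\
  (* the operators Q_f(H), V_f(H) and the map T_p preserve Z_p[[Y]] *)
  (forall H : fps K, fps_integral H ->
     (forall G, fps_integral G ->
        fps_integral (op_Q p H G) /\ fps_integral (op_V p H G)) /\
     fps_integral (T H)) /\
  (* T_p is 1-Lipschitz *)
  (forall (r : nat) (H H' : fps K), (1 <= r)%N ->
     fps_integral H -> fps_integral H' ->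
     fps_congr r H H' -> fps_congr r (T H) (T H')) /\
  L = L0 + p%:R *: T L /\
  (* strict p-adic contraction *)
  (forall (r : nat) (H H' : fps K), (1 <= r)%N ->
     fps_integral H -> fps_integral H' ->
     fps_congr r H H' ->
     fps_congr r.+1 (L0 + p%:R *: T H) (L0 + p%:R *: T H')) /\
  (* successive approximation *)
  (forall Lj : nat -> fps K,
     Lj 0%N = L0 ->
     (forall j : nat, Lj j.+1 = L0 + p%:R *: T (Lj j)) ->
     forall r : nat, (1 <= r)%N -> fps_congr r (Lj r.-1) L).
Proof.
move=> K L L0 T.
have iL : fdvd 0 L := fdvd_L_series p_pr.
have iL0 : fdvd 0 L0 := fdvd_L0_series p_pr.
have iT H : fdvd 0 H -> fdvd 0 (T H) by exact: fdvd_calT.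
have L_fixed : L = L0 + p%:R *: T L.
  apply: L_series_fixed_point => //; first exact: prime_gt1.
  by move=> n; exact: padic_natr_neq0.
have fdvd_scalep r (F : fps K) : fdvd r F -> fdvd r.+1 (p%:R *: F).
  by rewrite scaler_nat -mulr_natl; exact: fdvd_prime_mul.
have contraction r H H' : fdvd 0 H -> fdvd 0 H' -> fdvd r (H - H') ->
    fdvd r.+1 ((L0 + p%:R *: T H) - (L0 + p%:R *: T H')).
  move=> iH iH' rHH'; rewrite opprD addrACA subrr add0r -scalerBr.
  by apply: fdvd_scalep; exact: calT_lipschitz.
split; last split; last split; last split=> //; last split.
- by split; [|split]; apply/fps_integralP => //; exact: fdvd_C_series.
- move=> H /fps_integralP iH; split=> [G /fps_integralP iG|].
    by split; apply/fps_integralP; [exact: fdvd_op_Q | exact: fdvd_op_V].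
  by apply/fps_integralP; exact: iT.
- by move=> r H H' _ /fps_integralP iH /fps_integralP iH'; exact: calT_lipschitz.
- by move=> r H H' _ /fps_integralP iH /fps_integralP iH'; exact: contraction.
move=> Lj Lj0 LjS [//|r] _; rewrite [r.+1.-1]/=.
have iLj j : fdvd 0 (Lj j).
  elim: j => [|j IH]; rewrite ?Lj0 ?LjS //.
  by apply: fdvdD => //; apply: fdvd_le (leq0n 1) _; apply: fdvd_scalep; exact: iT.
elim: r => [|r IH]; rewrite ?Lj0 ?LjS fps_congrE L_fixed; last exact: contraction.
rewrite opprD addNKr; apply: fdvdN; apply: fdvd_scalep; exact: iT.
Qed.
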